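(* Let $\mathbb{F}$ be a finite field of constant characteristic $q$. Let $f,g\in\mathbb{F}[x_1,\dots,x_n]$ be $f=\prod_{i<j}(x_i+x_j+1)$ and $g=\prod_{i=1}^n(1-x_i)-1$. Then the system of equations $f=0$, $g=0$, $x_i^2-x_i=0$ ($i\in[n]$) is unsatisfiable, and every roABP-$\mathrm{IPS}_{\mathrm{LIN}'}$ refutation of it (in any order of the variables) has size $\exp(\Omega(n))$.
   Context: A read-once oblivious algebraic branching program (roABP) in variable order $v_{\pi(1)}<\dots<v_{\pi(N)}$ is a layered DAG with layers $V_0,\dots,V_N$, unique source in $V_0$, unique sink in $V_N$, edges only from $V_{\ell-1}$ to $V_\ell$ each labelled by a univariate polynomial in $v_{\pi(\ell)}$; it computes the sum over source–sink paths of the products of labels. Width $r=\max_\ell|V_\ell|$; size $N\cdot r\cdot D\cdot N$ with $D$ the maximal individual degree of labels. A roABP-$\mathrm{IPS}_{\mathrm{LIN}'}$ refutation of $\{f=0,g=0\}$ with Boolean axioms is a polynomial $C(\bar x,t_1,t_2,s_1,\dots,s_n)$ computed by an roABP (in some order of all its variables) with $C(\bar x,0,0,\bar0)=0$, $C(\bar x,f,g,x_1^2-x_1,\dots,x_n^2-x_n)=1$, and $C$ of degree $\le1$ in $t_1$ and in $t_2$; its size is the roABP's size. *)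

(* Defs.v *)
From mathcomp Require Import all_boot all_order all_fingroup all_algebra.
From mathcomp Require Import mpoly.

Set Implicit Arguments.
Unset Strict Implicit.
Unset Printing Implicit Defensive.

Import GRing.Theory.
Local Open Scope ring_scope.

(* [ro_order l] is the variable read between layers l and l+1, so the order
   v_{pi(1)} < ... < v_{pi(N)} is 'X_(ro_order 0), ..., 'X_(ro_order (N-1)).
   Values of [ro_label] on pairs that are not edges are never used. *)
Record roABP (F : fieldType) (N : nat) := RoABP {
  ro_vertex : finType;
  ro_layer : ro_vertex -> 'I_N.+1;
  ro_source : ro_vertex;
  ro_sink : ro_vertex;
  ro_sourceP : forall v, (ro_layer v == ord0) = (v == ro_source);
  ro_sinkP : forall v, (ro_layer v == ord_max) = (v == ro_sink);
  ro_edge : rel ro_vertex;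
  ro_edgeP : forall u v, ro_edge u v -> ro_layer v = (ro_layer u).+1 :> nat;
  ro_label : ro_vertex -> ro_vertex -> {poly F};
  ro_order : 'S_N
}.

Section RoABP.
Variables (F : fieldType) (N : nat) (A : roABP F N).

(* The l-th edge of a path p goes from p l to p (l+1). *)
Definition ro_path (p : {ffun 'I_N.+1 -> ro_vertex A}) : bool :=
  [&& p ord0 == ro_source A, p ord_max == ro_sink A &
      [forall l : 'I_N, ro_edge (p (widen_ord (leqnSn N) l)) (p (lift ord0 l))]].

Definition ro_poly : {mpoly F[N]} :=
  \sum_(p | ro_path p) \prod_(l < N)
    horner_alg ('X_(ro_order A l) : {mpoly F[N]})
      (ro_label (p (widen_ord (leqnSn N) l)) (p (lift ord0 l))).

Definition ro_width : nat :=
  (\max_(l < N.+1) #|[set v : ro_vertex A | ro_layer v == l]|)%N.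

Definition ro_degree : nat :=
  (\max_(e : ro_vertex A * ro_vertex A | ro_edge e.1 e.2)
     (size (ro_label e.1 e.2)).-1)%N.

Definition ro_size : nat := (N * ro_width * ro_degree * N)%N.

End RoABP.

(* The variables x_1..x_n, t_1, t_2, s_1..s_n of C, in this order, are those
   of {mpoly F[n + (2 + n)]}; [ips_subst] is C(x, a, b, h_1, ..., h_n). *)
Section IPS.
Variables (F : fieldType) (n : nat).
Implicit Types (C : {mpoly F[n + (2 + n)]}) (f g a b : {mpoly F[n]}).

Definition ips_subst C a b (h : 'I_n -> {mpoly F[n]}) : {mpoly F[n]} :=
  C \mPo [tuple of [tuple 'X_i | i < n] ++
           ([tuple of [tuple a; b] ++ [tuple h i | i < n]])].

Definition t_var (k : 'I_2) : 'I_(n + (2 + n)) := rshift n (lshift n k).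

Definition bool_axiom (i : 'I_n) : {mpoly F[n]} := 'X_i ^+ 2 - 'X_i.

Definition ips_lin'_refutation f g C : Prop :=
  [/\ ips_subst C 0 0 (fun=> 0) = 0,
      ips_subst C f g bool_axiom = 1
    & forall (k : 'I_2) (m : 'X_{1.. n + (2 + n)}),
        m \in msupp C -> (m (t_var k) <= 1)%N].

Definition roABP_ips_lin'_refutation f g (A : roABP F (n + (2 + n))) : Prop :=
  ips_lin'_refutation f g (ro_poly A).

Definition satisfiable f g : Prop :=
  exists a : 'I_n -> F,
    [/\ f.@[a] = 0, g.@[a] = 0 & forall i, (bool_axiom i).@[a] = 0].

End IPS.

Definition f_poly (F : fieldType) (n : nat) : {mpoly F[n]} :=
  \prod_(i < n) \prod_(j < n | (i < j)%N) ('X_i + 'X_j + 1).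

Definition g_poly (F : fieldType) (n : nat) : {mpoly F[n]} :=
  \prod_(i < n) (1 - 'X_i) - 1.

(* Main.v *)
(* Given a refutation C, put D := 1 - C(x, 0, g, x^2 - x).  Since
   C(x, f, g, x^2 - x) = 1, D vanishes wherever f does; since C(x, 0, 0, 0) = 0,
   it equals 1 at the origin.

   An roABP reads each index i twice, through x_i and through s_i.  Cut its
   reading order into four blocks of almost equal size: for one of the three
   ways of pairing the blocks, linearly many indices have both reads in the
   first pair of blocks, and linearly many have both in the second.  Matching
   m = Omega(n) of the former with m of the latter gives index pairs
   (i_k, j_k), k < m.

   For s, t in {0,1}^m, let x_(i_k) be X_k or -1 - X_k according to s_k, let
   x_(j_k) be X_k or -1 - X_k according to t_k, and let the other x_i be 0.  If
   s_k and t_k differ, then x_(i_k) + x_(j_k) + 1 = 0, so f and hence D vanish.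
   If s = t, all the x_i vanish at X_k = - s_k, so D is a nonzero polynomial in
   the X_k.  The matrix of these values of D, indexed by s and t, is thus
   diagonal and nonsingular, of rank 2^m.  On the other hand, the values at such
   points of an roABP of width r form a matrix of rank at most r^4; as C has
   degree at most 1 in t_2 and g + 1 is a product of univariate factors, the
   matrix of D has rank O(r^4), so r is exponential in n. *)
Require Import Defs.
From mathcomp Require Import all_boot all_order all_fingroup all_algebra.
From mathcomp Require Import reals sequences exp.
From mathcomp Require Import mpoly.
From mathcomp Require Import zify ring.

Set Implicit Arguments.
Unset Strict Implicit.
Unset Printing Implicit Defensive.

Import GRing.Theory Num.Theory.
Local Open Scope ring_scope.

Section RankAtMost.
Variables (R : comNzRingType) (S T : Type).
Implicit Types (M : S -> T -> R) (k : nat).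

Definition rank_at_most k M : Prop :=
  exists2 r : seq ((S -> R) * (T -> R)), (size r <= k)%N &
    forall s t, M s t = \sum_(ab <- r) ab.1 s * ab.2 t.

Lemma eq_rank_at_most k M M' :
  M =2 M' -> rank_at_most k M -> rank_at_most k M'.
Proof. by move=> eqM [r le_r defM]; exists r => // s t; rewrite -eqM. Qed.

Lemma rank_at_most_leq k k' M :
  (k <= k')%N -> rank_at_most k M -> rank_at_most k' M.
Proof. by move=> le_k [r le_r defM]; exists r; first exact: leq_trans le_k. Qed.

Lemma rank_at_most_outer (a : S -> R) (b : T -> R) :
  rank_at_most 1 (fun s t => a s * b t).
Proof. by exists [:: (a, b)] => // s t; rewrite big_seq1. Qed.

Lemma rank_at_most_const (c : R) : rank_at_most 1 (fun _ _ => c).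
Proof.
apply: eq_rank_at_most (rank_at_most_outer (fun=> c) (fun=> 1)) => s t.
exact: mulr1.
Qed.

Lemma rank_at_mostD k k' M M' :
  rank_at_most k M -> rank_at_most k' M' ->
  rank_at_most (k + k') (fun s t => M s t + M' s t).
Proof.
move=> [r le_r defM] [r' le_r' defM']; exists (r ++ r').
  by rewrite size_cat leq_add.
by move=> s t; rewrite big_cat defM defM'.
Qed.

Lemma rank_at_mostM k k' M M' :
  rank_at_most k M -> rank_at_most k' M' ->
  rank_at_most (k * k') (fun s t => M s t * M' s t).
Proof.
move=> [r le_r defM] [r' le_r' defM'].
exists [seq (fun s => p.1 s * q.1 s, fun t => p.2 t * q.2 t)
         | p <- r, q <- r'].
  by rewrite size_allpairs leq_mul.
move=> s t; rewrite big_allpairs_dep defM defM' mulr_suml.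
apply: eq_bigr => p _.
by rewrite mulr_sumr; apply: eq_bigr => q _; rewrite mulrACA.
Qed.

Lemma rank_at_mostB k k' M M' :
  rank_at_most k M -> rank_at_most k' M' ->
  rank_at_most (k + k') (fun s t => M s t - M' s t).
Proof.
move=> rkM rkM'; have := rank_at_mostM (rank_at_most_const (-1)) rkM'.
rewrite mul1n => /(rank_at_mostD rkM); apply: eq_rank_at_most => s t.
by rewrite mulN1r.
Qed.

Lemma rank_at_most_sum (I : finType) (A : {set I}) k (M : I -> S -> T -> R) :
  (forall i, i \in A -> rank_at_most k (M i)) ->
  rank_at_most (#|A| * k) (fun s t => \sum_(i in A) M i s t).
Proof.
move=> rkM; suff rk_seq (e : seq I) : {subset e <= A} ->
    rank_at_most (size e * k) (fun s t => \sum_(i <- e) M i s t).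
  have := rk_seq (enum A); rewrite cardE => rkA.
  apply: eq_rank_at_most (rkA _) => [s t|i]; last by rewrite mem_enum.
  by rewrite big_enum.
elim: e => [|i e IH] sub_eA.
  by exists [::] => // s t; rewrite !big_nil.
have rk_i := rkM i (sub_eA i (mem_head i e)).
have rk_e := IH (fun j e_j => sub_eA j (mem_behead (s := i :: e) e_j)).
by apply: eq_rank_at_most (rank_at_mostD rk_i rk_e) => s t; rewrite big_cons.
Qed.

End RankAtMost.

Lemma rank_at_most_diag (R : idomainType) (S : finType) (k : nat)
    (M : S -> S -> R) :
  (forall s t, s != t -> M s t = 0) -> (forall s, M s s != 0) ->
  rank_at_most k M -> (#|S| <= k)%N.
Proof.
move=> M_offdiag M_diag [r le_r defM]; apply: leq_trans le_r.
pose K := {fraction R}.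
pose U : 'M[K]_(#|S|, size r) :=
  \matrix_(i, l) tofrac ((tnth (in_tuple r) l).1 (enum_val i)).
pose V : 'M[K]_(size r, #|S|) :=
  \matrix_(l, j) tofrac ((tnth (in_tuple r) l).2 (enum_val j)).
pose d : 'rV[K]_#|S| := \row_i tofrac (M (enum_val i) (enum_val i)).
have factor_d : diag_mx d = U *m V.
  apply/matrixP => i j; rewrite !mxE.
  transitivity (tofrac (M (enum_val i) (enum_val j)) : K).
    case: eqVneq => [->|neq_ij]; first by rewrite mulr1n.
    by rewrite mulr0n M_offdiag ?rmorph0 // (inj_eq enum_val_inj).
  rewrite defM big_tnth rmorph_sum; apply: eq_bigr => l _.
  by rewrite !mxE rmorphM.
have : \rank (diag_mx d) = #|S|.
  apply: mxrank_unit; rewrite unitmxE det_diag unitfE.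
  by apply/prodf_neq0 => i _; rewrite mxE tofrac_eq0.
by move=> <-; rewrite factor_d mulmx_max_rank.
Qed.

Section FfunCons.
Variable V : Type.

Definition ffun_cons k (x : V) (p : {ffun 'I_k -> V}) : {ffun 'I_k.+1 -> V} :=
  [ffun i => if unlift ord0 i is Some j then p j else x].

Lemma ffun_cons0 k x (p : {ffun 'I_k -> V}) : ffun_cons x p ord0 = x.
Proof. by rewrite ffunE unlift_none. Qed.

Lemma ffun_consS k x (p : {ffun 'I_k -> V}) i :
  ffun_cons x p (lift ord0 i) = p i.
Proof. by rewrite ffunE liftK. Qed.

End FfunCons.

Lemma big_ffun_cons (R : Type) (idx : R) (op : Monoid.com_law idx) (V : finType)
    (k : nat) (P : pred {ffun 'I_k.+1 -> V}) (F : {ffun 'I_k.+1 -> V} -> R) :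
  \big[op/idx]_(p | P p) F p =
  \big[op/idx]_(x : V) \big[op/idx]_(p : {ffun 'I_k -> V} | P (ffun_cons x p))
    F (ffun_cons x p).
Proof.
rewrite pair_big_dep /= (reindex (fun xp => ffun_cons xp.1 xp.2)) //=.
exists (fun p : {ffun 'I_k.+1 -> V} => (p ord0, [ffun i => p (lift ord0 i)])).
  move=> [x p] _ /=; rewrite ffun_cons0; congr (_, _).
  by apply/ffunP => i; rewrite ffunE ffun_consS.
move=> p _; apply/ffunP => i; rewrite ffunE; case: unliftP => [j|] -> //=.
by rewrite ffunE.
Qed.

Section WalkSum.
Variables (R : comNzRingType) (V : finType).
Implicit Types (w : nat -> V -> V -> R) (X : nat -> {set V}) (cut : nat -> nat).

Fixpoint walk_sum w (a k : nat) (u v : V) : R :=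
  if k is k'.+1 then \sum_x w a u x * walk_sum w a.+1 k' x v else (u == v)%:R.

Lemma eq_walk_sum w w' a k u v :
  (forall l, (a <= l < a + k)%N -> w l =2 w' l) ->
  walk_sum w a k u v = walk_sum w' a k u v.
Proof.
elim: k a u => //= k IH a u eqw; apply: eq_bigr => x _.
rewrite eqw ?IH // => [l ?|]; last by lia.
by apply: eqw; lia.
Qed.

Lemma walk_sumD w a k k' u v :
  walk_sum w a (k + k') u v =
  \sum_x walk_sum w a k u x * walk_sum w (a + k) k' x v.
Proof.
elim: k a u => [|k IH] a u /=.
  rewrite addn0 (bigD1 u) //= eqxx mul1r big1 ?addr0 // => x /negPf.
  by rewrite eq_sym => ->; rewrite mul0r.
under eq_bigr => x _ do rewrite IH mulr_sumr.
rewrite exchange_big /=; apply: eq_bigr => y _.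
rewrite mulr_suml; apply: eq_bigr => x _.
by rewrite mulrA addSnnS.
Qed.

Lemma big_ffun_walk_sum w a k u v :
  \sum_(p : {ffun 'I_k.+1 -> V} | (p ord0 == u) && (p ord_max == v))
     \prod_(l < k) w (a + l)%N (p (widen_ord (leqnSn k) l)) (p (lift ord0 l))
  = walk_sum w a k u v.
Proof.
elim: k a u => [|k IH] a u.
  rewrite /= (eq_bigl (fun p => (p == [ffun=> u]) && (u == v))) => [|p].
    case: eqP => _; last by rewrite big_pred0 // => p; rewrite andbF.
    rewrite (big_pred1 [ffun=> u]) ?big_ord0 // => p; exact: andbT.
  rewrite (_ : ord_max = ord0); last exact/val_inj.
  apply/andP/andP => [[/eqP p0 /eqP <-]|[/eqP-> /eqP->]]; last by rewrite ffunE.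
  by rewrite -p0; split=> //; apply/eqP/ffunP => i; rewrite ffunE ord1.
rewrite big_ffun_cons (bigD1 u) //=.
rewrite [X in _ + X]big1 ?addr0 => [|x /negPf ne_x]; last first.
  by rewrite big_pred0 // => p; rewrite ffun_cons0 ne_x.
rewrite (partition_big (fun p : {ffun 'I_k.+1 -> V} => p ord0) predT) //=.
apply: eq_bigr => x _; rewrite -IH mulr_sumr; apply: eq_big => p.
  rewrite ffun_cons0 eqxx (_ : ord_max = lift ord0 ord_max); last exact/val_inj.
  by rewrite ffun_consS andbC.
move=> /andP[_ /eqP <-]; rewrite big_ord_recl /=; congr (_ * _).
  rewrite addn0 ffun_consS (_ : widen_ord _ _ = ord0) ?ffun_cons0 //.
  exact/val_inj.
apply: eq_bigr => l _; rewrite ffun_consS /bump /= add1n addSnnS.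
rewrite (_ : widen_ord _ _ = lift ord0 (widen_ord (leqnSn k) l)).
  by rewrite ffun_consS.
exact/val_inj.
Qed.

Lemma walk_sum_cut w cut j b u v : {homo cut : a b / (a <= b)%N} ->
  walk_sum (fun b => walk_sum w (cut b) (cut b.+1 - cut b)) b j u v =
  walk_sum w (cut b) (cut (b + j)%N - cut b) u v.
Proof.
move=> cut_mono; elim: j b u => [|j IH] b u; first by rewrite addn0 subnn.
have le_cutS := cut_mono b b.+1 (leqnSn b).
have le_cut_end : (cut b.+1 <= cut (b + j.+1)%N)%N by apply: cut_mono; lia.
have -> : (cut (b + j.+1)%N - cut b =
    (cut b.+1 - cut b) + (cut (b.+1 + j)%N - cut b.+1))%N.
  by rewrite addSnnS; lia.
by rewrite walk_sumD subnKC //=; apply: eq_bigr => x _; rewrite IH.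
Qed.

Definition graded X w : Prop :=
  forall l u x, u \in X l -> x \notin X l.+1 -> w l u x = 0.

Lemma graded_walk_sum X w a k u v :
  graded X w -> u \in X a -> v \notin X (a + k)%N -> walk_sum w a k u v = 0.
Proof.
move=> grw; elim: k a u => [|k IH] a u Xu nXv /=.
  by case: eqP nXv => // <-; rewrite addn0 Xu.
apply: big1 => x _; have [Xx|nXx] := boolP (x \in X a.+1); last first.
  by rewrite grw ?mul0r.
by rewrite IH ?mulr0 // addSnnS.
Qed.

Lemma graded_cut X w cut : {homo cut : a b / (a <= b)%N} -> graded X w ->
  graded (X \o cut) (fun b => walk_sum w (cut b) (cut b.+1 - cut b)).
Proof.
move=> cut_mono grw b u x /= Xu nXx; apply: (graded_walk_sum grw Xu).
by rewrite subnKC // cut_mono.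
Qed.

Lemma rank_walk_sum (S T : Type) (wS : S -> nat -> V -> V -> R)
    (wT : T -> nat -> V -> V -> R) X (side : pred nat) (r a k : nat) (u v : V) :
  (forall s, graded X (wS s)) -> (forall t, graded X (wT t)) ->
  (forall l, #|X l| <= r)%N -> u \in X a ->
  rank_at_most (r ^ k) (fun s t =>
    walk_sum (fun l => if side l then wS s l else wT t l) a k u v).
Proof.
move=> grS grT card_X; elim: k a u => [|k IH] a u Xu /=.
  exact: rank_at_most_const.
pose w s t l := if side l then wS s l else wT t l.
apply: (@rank_at_most_leq _ _ _ (#|X a.+1| * r ^ k)).
  by rewrite expnS leq_mul2r card_X orbT.
apply: (@eq_rank_at_most _ _ _ _ (fun s t =>
    \sum_(x in X a.+1) w s t a u x * walk_sum (w s t) a.+1 k x v)) => [s t|].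
  rewrite big_mkcond; apply: eq_bigr => x _; case: ifPn => // nXx.
  by case: (side a); rewrite ?grS ?grT ?mul0r.
apply: rank_at_most_sum => x Xx; rewrite -[(r ^ k)%N]mul1n.
apply: rank_at_mostM; last exact: IH.
apply: (@eq_rank_at_most _ _ _ _ (fun s t =>
    (if side a then wS s a u x else 1) * (if side a then 1 else wT t a u x)));
  last exact: rank_at_most_outer.
by move=> s t; rewrite /w; case: (side a); rewrite ?mulr1 ?mul1r.
Qed.

End WalkSum.

Lemma exists_common_labelling (T : finType) (m : nat) (Y Z : {set T}) :
  [disjoint Y & Z] -> (m <= #|Y|)%N -> (m <= #|Z|)%N ->
  exists label : T -> option 'I_m,
  [/\ forall i, label i -> i \in Y :|: Z,
      forall k, exists2 i, i \in Y & label i = Some k &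
      forall k, exists2 i, i \in Z & label i = Some k].
Proof.
move=> disYZ le_mY le_mZ.
pose label_in (X : {set T}) i : option 'I_m := insub (index i (enum X)).
have label_sub (X : {set T}) i : (m <= #|X|)%N -> label_in X i -> i \in X.
  move=> le_mX; rewrite /label_in; case: insubP => // k lt_i _ _.
  by rewrite -mem_enum -index_mem -cardE (leq_trans lt_i).
have label_onto (X : {set T}) k : (m <= #|X|)%N ->
    exists2 i, i \in X & label_in X i = Some k.
  move=> le_mX; have lt_k : (k < #|X|)%N := leq_trans (ltn_ord k) le_mX.
  exists (enum_val (Ordinal lt_k)); first exact: enum_valP.
  rewrite /label_in index_uniq ?enum_uniq -?cardE //; exact: valK.
exists (fun i => if i \in Y then label_in Y i else label_in Z i); split.
- by move=> i; rewrite inE; case: ifP => //= _; exact: label_sub.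
- move=> k; have [i Yi label_i] := label_onto Y k le_mY.
  by exists i => //; rewrite Yi.
- move=> k; have [i Zi label_i] := label_onto Z k le_mZ.
  by exists i; rewrite // (disjointFl disYZ Zi).
Qed.

Lemma leq_card_preim_disjoint (T U : finType) (p1 p2 : T -> U) (P : pred U) :
  injective p1 -> injective p2 -> (forall i j, p1 i != p2 j) ->
  (#|[set i | P (p1 i)]| + #|[set i | P (p2 i)]| <= #|[set x | P x]|)%N.
Proof.
move=> p1_inj p2_inj p1_neq_p2.
rewrite -(card_imset _ p1_inj) -(card_imset _ p2_inj).
have disj_images :
    [disjoint p1 @: [set i | P (p1 i)] & p2 @: [set i | P (p2 i)]].
  apply/pred0P => x /=; apply/andP => -[/imsetP[i _ ->] /imsetP[j _ /eqP]].
  exact/negP.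
rewrite -(eqTleqif (leq_card_setU _ _) disj_images).
apply: subset_leq_card; apply/subsetP => x.
by rewrite in_setU => /orP[] /imsetP[i]; rewrite !inE => Pi ->.
Qed.

Section BlockPairing.
Local Open Scope nat_scope.
Variables (T : finType) (u v : T -> nat).
Implicit Types (side : pred nat) (a b c d m B : nat).

Definition both_in side : {set T} := [set i | side (u i) && side (v i)].

Lemma both_in_predC_balance side B :
  #|[set i | side (u i)]| + #|[set i | side (v i)]| <= 2 * B ->
  #|both_in side| + #|T| <= #|both_in (predC side)| + 2 * B.
Proof.
set Eu := [set i | side (u i)]; set Ev := [set i | side (v i)] => le_2B.
have -> : both_in side = Eu :&: Ev by apply/setP => i; rewrite !inE.
have -> : both_in (predC side) = ~: (Eu :|: Ev).
  by apply/setP => i; rewrite !inE negb_or.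
by have := (cardsUI Eu Ev, cardsC (Eu :|: Ev)) => -[]; lia.
Qed.

Variable B : nat.
Hypothesis card_block : forall b,
  #|[set i | u i == b]| + #|[set i | v i == b]| <= B.

Lemma card_two_blocks side b c :
  (forall i, side (u i) -> u i \in [:: b; c]) ->
  (forall i, side (v i) -> v i \in [:: b; c]) ->
  #|[set i | side (u i)]| + #|[set i | side (v i)]| <= 2 * B.
Proof.
have card_side (w : T -> nat) :
    (forall i, side (w i) -> w i \in [:: b; c]) ->
    #|[set i | side (w i)]| <= #|[set i | w i == b]| + #|[set i | w i == c]|.
  move=> side_bc; apply: leq_trans (leq_card_setU _ _).
  by apply: subset_leq_card; apply/subsetP => i; rewrite !inE => /side_bc;
    rewrite !inE.
move=> /card_side card_u /card_side card_v.
by have := (card_block b, card_block c) => -[]; lia.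
Qed.

Hypotheses (u_lt4 : forall i, u i < 4) (v_lt4 : forall i, v i < 4).

Definition block_pair a : pred nat := pred2 0 a.

Lemma block_pair_balance a : 0 < a < 4 ->
  #|both_in (block_pair a)| + #|T|
    <= #|both_in (predC (block_pair a))| + 2 * B /\
  #|both_in (predC (block_pair a))| + #|T|
    <= #|both_in (block_pair a)| + 2 * B.
Proof.
move=> a_lt4; split; first apply: both_in_predC_balance.
  by apply: (@card_two_blocks _ 0 a) => i; rewrite !inE.
have -> : both_in (block_pair a) = both_in (predC (predC (block_pair a))).
  by apply/setP => i; rewrite !inE !negbK.
apply: both_in_predC_balance.
have [b [c bcE]] : exists b c, forall x,
    x < 4 -> ~~ block_pair a x -> x \in [:: b; c].
  case: a a_lt4 => [|[|[|[|//]]]] // _; [exists 2, 3|exists 1, 3|exists 1, 2];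
    by move=> [|[|[|[|]]]].
by apply: (@card_two_blocks _ b c) => i; exact: bcE.
Qed.

(* Any two of the four blocks stay together in one of the three ways of
   splitting the blocks into pairs. *)
Lemma block_pair_cover :
  exists2 a, 0 < a < 4 &
    #|T| <= 3 * (#|both_in (block_pair a)| + #|both_in (predC (block_pair a))|).
Proof.
pose unsplit a := both_in (block_pair a) :|: both_in (predC (block_pair a)).
have cover : [set: T] \subset unsplit 1 :|: unsplit 2 :|: unsplit 3.
  apply/subsetP => i _; rewrite !inE /block_pair /=.
  by case: (u i) (v i) (u_lt4 i) (v_lt4 i) => [|[|[|[|?]]]] [|[|[|[|?]]]].
have [a a_lt4 le_T] : exists2 a, 0 < a < 4 & #|T| <= 3 * #|unsplit a|.
  have : #|T| <= #|unsplit 1| + #|unsplit 2| + #|unsplit 3|.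
    rewrite -cardsT; apply: leq_trans (subset_leq_card cover) _.
    apply: leq_trans (leq_card_setU _ _) _.
    by rewrite leq_add2r; exact: leq_card_setU.
  have [le_unsplit1|] := leqP #|T| (3 * #|unsplit 1|); first by exists 1.
  have [le_unsplit2|] := leqP #|T| (3 * #|unsplit 2|); first by exists 2.
  by exists 3 => //; lia.
exists a => //; apply: leq_trans le_T _; rewrite leq_mul2l.
exact: leq_card_setU.
Qed.

(* As the blocks have almost equal size, a splitting that leaves many indices
   inside its pairs of blocks leaves about as many inside each of the two. *)
Lemma exists_balanced_side d m :
  2 * B <= #|T| + d -> 6 * m + 3 * d <= #|T| ->
  exists side, m <= #|both_in side| /\ m <= #|both_in (predC side)|.
Proof.
move=> le_B le_m; have [a a_lt4 le_T] := block_pair_cover.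
by exists (block_pair a); have [] := block_pair_balance a_lt4; lia.
Qed.

Lemma exists_balanced_pairing d m :
  2 * B <= #|T| + d -> 6 * m + 3 * d <= #|T| ->
  exists (side : pred nat) (pair_of : T -> option 'I_m),
  [/\ forall i, pair_of i -> side (v i) = side (u i),
      forall k, exists2 i, side (u i) & pair_of i = Some k &
      forall k, exists2 i, ~~ side (u i) & pair_of i = Some k].
Proof.
move=> le_B le_m; have [side [le_in le_out]] := exists_balanced_side le_B le_m.
have disj : [disjoint both_in side & both_in (predC side)].
  apply/pred0P => i; rewrite /= !inE /=.
  by case: (side (u i)) => //=; rewrite andbF.
have [pair_of [pair_in in_of out_of]] :=
  exists_common_labelling disj le_in le_out.
exists side, pair_of; split=> [i /pair_in|k|k].
- by rewrite !inE /=; case: (side (u i)) (side (v i)) => [] [].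
- by have [i] := in_of k; rewrite inE => /andP[in_i _]; exists i.
- by have [i] := out_of k; rewrite inE => /andP[out_i _]; exists i.
Qed.

End BlockPairing.

Section Evaluation.
Variables (F : fieldType) (R : comNzRingType) (phi : {rmorphism F -> R}).

Lemma eq_mmap N (h h' : 'I_N -> R) (p : {mpoly F[N]}) :
  h =1 h' -> mmap phi h p = mmap phi h' p.
Proof. by move=> eqh; apply: eq_bigr => m _; rewrite (mmap1_eq m eqh). Qed.

Lemma rmorph_mmap (R' : comNzRingType) (psi : {rmorphism R -> R'})
    (phi' : {rmorphism F -> R'}) N (h : 'I_N -> R) (p : {mpoly F[N]}) :
  (forall c, psi (phi c) = phi' c) ->
  psi (mmap phi h p) = mmap phi' (psi \o h) p.
Proof.
move=> phi'E; rewrite rmorph_sum; apply: eq_bigr => m _.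
rewrite rmorphM phi'E rmorph_prod; congr (_ * _); apply: eq_bigr => i _.
exact: rmorphXn.
Qed.

Lemma mmap_affine N (p : {mpoly F[N]}) (v : 'I_N) (h : 'I_N -> R) :
  (forall m, m \in msupp p -> (m v <= 1)%N) ->
  mmap phi h p = (1 - h v) * mmap phi [eta h with v |-> 0] p
               + h v * mmap phi [eta h with v |-> 1] p.
Proof.
move=> deg_v; rewrite !mulr_sumr -big_split /=.
apply: eq_big_seq => m /deg_v deg_m.
have mmap1_with x : mmap1 [eta h with v |-> x] m =
    x ^+ m v * \prod_(i < N | i != v) h i ^+ m i.
  rewrite /mmap1 (bigD1 v) //= eqxx; congr (_ * _).
  by apply: eq_bigr => i /negPf ->.
rewrite !mmap1_with {1}/mmap1 (bigD1 v) //=.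
by case: (m v) deg_m => [|[|//]] _; rewrite ?expr0 ?expr1; ring.
Qed.

Lemma mmap_horner_alg N (h : 'I_N -> R) (q : {poly F}) (i : 'I_N) :
  mmap phi h (horner_alg 'X_i q) = (map_poly phi q).[h i].
Proof.
elim/poly_ind: q => [|q c IH]; first by rewrite !rmorph0 horner0.
rewrite !rmorphD !rmorphM /= !hornerE /= map_polyX map_polyC !hornerE -IH.
rewrite /horner_alg /horner_morph map_polyX map_polyC !hornerE /=.
by rewrite mmapZ rmorph1 mulr1 mmapX mmap1U.
Qed.

End Evaluation.

Section RoABPEvaluation.
Variables (F : fieldType) (R : comNzRingType) (phi : {rmorphism F -> R}).
Variables (N : nat) (A : roABP F N).

Lemma mmap_ro_degree0 h h' :
  ro_degree A = 0%N -> mmap phi h (ro_poly A) = mmap phi h' (ro_poly A).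
Proof.
move=> deg0; rewrite !rmorph_sum; apply: eq_bigr => p /and3P[_ _ /forallP edge].
rewrite !rmorph_prod; apply: eq_bigr => l _ /=; rewrite !mmap_horner_alg.
move: (p _) (p _) (edge l) => v u edge_uv.
have : ((size (ro_label u v)).-1 <= 0)%N.
  by rewrite -deg0 /ro_degree (leq_bigmax_cond (u, v)).
rewrite leqn0 -subn1 subn_eq0 => /size1_polyC ->.
by rewrite map_polyC !hornerE.
Qed.

Definition ro_weight (h : 'I_N -> R) (l : nat) (u v : ro_vertex A) : R :=
  if insub l is Some k then
    (ro_edge u v)%:R * (map_poly phi (ro_label u v)).[h (ro_order A k)]
  else 0.

Lemma mmap_ro_poly h :
  mmap phi h (ro_poly A) =
  walk_sum (ro_weight h) 0 N (ro_source A) (ro_sink A).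
Proof.
rewrite rmorph_sum /= -big_ffun_walk_sum /ro_path.
rewrite [RHS](bigID (fun p : {ffun 'I_N.+1 -> ro_vertex A} => [forall l : 'I_N,
  ro_edge (p (widen_ord (leqnSn N) l)) (p (lift ord0 l))])) /=.
rewrite [X in _ = _ + X]big1 ?addr0; last first.
  move=> p /andP[_ /forallPn[l /negPf not_edge]].
  by rewrite (bigD1 l) //= /ro_weight add0n valK not_edge !mul0r.
apply: eq_big => [p|p /and3P[_ _ /forallP edge]]; first by rewrite andbA.
rewrite rmorph_prod; apply: eq_bigr => l _ /=.
by rewrite /ro_weight add0n valK edge mul1r mmap_horner_alg.
Qed.

Definition ro_layer_set (l : nat) : {set ro_vertex A} :=
  [set v | ro_layer v == l :> nat].

Lemma card_ro_layer_set l : (#|ro_layer_set l| <= ro_width A)%N.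
Proof.
have [lt_l|ge_l] := ltnP l N.+1.
  apply: leq_trans (leq_bigmax (Ordinal lt_l)).
  by apply: subset_leq_card; apply/subsetP => v; rewrite !inE.
rewrite (_ : ro_layer_set l = set0) ?cards0 //; apply/setP => v; rewrite !inE.
by rewrite ltn_eqF // (leq_trans (ltn_ord _)).
Qed.

Lemma graded_ro_weight h : graded ro_layer_set (ro_weight h).
Proof.
move=> l u v; rewrite !inE /ro_weight => /eqP lu; case: insub => // k.
by case: (boolP (ro_edge u v)) => [/ro_edgeP ->|]; rewrite ?lu ?eqxx ?mul0r.
Qed.

Definition ro_block (B : nat) (v : 'I_N) : nat := ((ro_order A)^-1%g v %/ B)%N.

Lemma rank_ro_poly (S T : Type) (hS : S -> 'I_N -> R) (hT : T -> 'I_N -> R)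
    (side : pred nat) (B j : nat) :
  (N <= j * B)%N ->
  rank_at_most (ro_width A ^ j) (fun s t =>
    mmap phi (fun v => if side (ro_block B v) then hS s v else hT t v)
      (ro_poly A)).
Proof.
move=> le_N; pose cut b := minn (b * B) N.
have cut_mono : {homo cut : a b / (a <= b)%N}.
  by move=> a b le_ab; rewrite /cut; have := leq_mul2r B a b; lia.
pose block_sum h b := walk_sum (ro_weight h) (cut b) (cut b.+1 - cut b).
have gr_block h : graded (ro_layer_set \o cut) (block_sum h).
  exact/graded_cut/graded_ro_weight.
apply: eq_rank_at_most (rank_walk_sum side j (ro_sink A)
  (fun s => gr_block (hS s)) (fun t => gr_block (hT t))
  (fun b => card_ro_layer_set (cut b))
  (_ : ro_source A \in ro_layer_set (cut 0%N))) => [s t|]; last first.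
  have : ro_layer (ro_source A) == ord0 by rewrite ro_sourceP.
  by rewrite inE /cut mul0n min0n => /eqP ->.
set h := (X in mmap phi X); rewrite mmap_ro_poly.
have -> : walk_sum (ro_weight h) 0 N (ro_source A) (ro_sink A) =
    walk_sum (block_sum h) 0 j (ro_source A) (ro_sink A).
  by rewrite walk_sum_cut // add0n /cut mul0n min0n subn0 (minn_idPr le_N).
symmetry; apply: eq_walk_sum => b _ u v; rewrite /block_sum.
have weightE l : (cut b <= l < cut b + (cut b.+1 - cut b))%N ->
    ro_weight h l =2 if side b then ro_weight (hS s) l else ro_weight (hT t) l.
  rewrite subnKC ?cut_mono // /cut => /andP[ge_l lt_l] x y; rewrite /ro_weight.
  have lbE : (l %/ B = b)%N.
    by apply/eqP; rewrite eqn_leq -ltnS ltn_divLR ?leq_divRL; nia.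
  case: insubP => [k _ kE|_]; last by case: ifP.
  by rewrite /h /ro_block permK kE lbE; case: ifP.
case: (side b) weightE => weightE; exact: eq_walk_sum.
Qed.

End RoABPEvaluation.

Lemma card_ro_block (F : fieldType) (N : nat) (A : roABP F N) (B b : nat) :
  (0 < B)%N -> (#|[set v | ro_block A B v == b]| <= B)%N.
Proof.
move=> B0; rewrite -[leqRHS]card_ord.
pose pos := (ro_order A)^-1%g; pose offset v := Ordinal (ltn_pmod (pos v) B0).
apply: (@leq_card_in _ _ offset) => v w; rewrite !inE /ro_block -/pos.
move=> /eqP vb /eqP wb [eq_mod]; apply: (@perm_inj _ pos); apply: val_inj => /=.
by rewrite (divn_eq (pos v) B) (divn_eq (pos w) B) vb wb eq_mod.
Qed.

Section IpsSubst.
Variables (F : fieldType) (n : nat).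
Implicit Types (C : {mpoly F[n + (2 + n)]}) (f g a b : {mpoly F[n]}).

Definition x_var (i : 'I_n) : 'I_(n + (2 + n)) := lshift (2 + n) i.
Definition s_var (i : 'I_n) : 'I_(n + (2 + n)) := rshift n (rshift 2 i).

Variant ips_var_spec : 'I_(n + (2 + n)) -> Prop :=
  | IpsX i : ips_var_spec (x_var i)
  | IpsT k : ips_var_spec (t_var n k)
  | IpsS i : ips_var_spec (s_var i).

Lemma ips_varP v : ips_var_spec v.
Proof.
rewrite -(splitK v); case: (split v) => [i|w]; first exact: IpsX.
by rewrite -(splitK w); case: (split w) => [k|i]; [exact: IpsT|exact: IpsS].
Qed.

Definition ips_point (R : Type) (x : 'I_n -> R) (t1 t2 : R) (s : 'I_n -> R)
    (v : 'I_(n + (2 + n))) : R :=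
  match split v with
  | inl i => x i
  | inr w => match split w with
             | inl k => if k == ord0 then t1 else t2
             | inr i => s i
             end
  end.

Section IpsPoint.
Variables (R : Type) (x : 'I_n -> R) (t1 t2 : R) (s : 'I_n -> R).

Lemma ips_point_x i : ips_point x t1 t2 s (x_var i) = x i.
Proof. by rewrite /ips_point (unsplitK (inl i)). Qed.

Lemma ips_point_t k :
  ips_point x t1 t2 s (t_var n k) = if k == ord0 then t1 else t2.
Proof.
rewrite /ips_point /t_var (unsplitK (inr (lshift n k))).
by rewrite (unsplitK (inl k)).
Qed.

Lemma ips_point_s i : ips_point x t1 t2 s (s_var i) = s i.
Proof. by rewrite /ips_point !(unsplitK (inr _)). Qed.

Lemma ips_point_comp (R' : Type) (psi : R -> R') :
  psi \o ips_point x t1 t2 s =1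
  ips_point (psi \o x) (psi t1) (psi t2) (psi \o s).
Proof.
move=> v; rewrite /ips_point /=; case: split => // w.
by case: split => // k; case: ifP.
Qed.

End IpsPoint.

Lemma ips_point_with_t2 (R : Type) (x : 'I_n -> R) t1 t2 t2' s :
  [eta ips_point x t1 t2 s with t_var n ord_max |-> t2'] =1
  ips_point x t1 t2' s.
Proof.
move=> v /=; case: eqP => [->|]; first by rewrite ips_point_t.
case: (ips_varP v) => [i|k|i] ne_t2; rewrite ?ips_point_x ?ips_point_s //.
rewrite !ips_point_t; case: ifP ne_t2 => // k0 [].
by congr t_var; apply: val_inj; case: k k0 => [[|[|]]].
Qed.

Lemma ips_substE C a b (h : 'I_n -> {mpoly F[n]}) :
  ips_subst C a b h =
  mmap (@mpolyC n F) (ips_point (fun i => 'X_i) a b h) C.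
Proof.
apply: eq_mmap => v; case: (ips_varP v) => [i|k|i].
- by rewrite ips_point_x tnth_lshift tnth_mktuple.
- rewrite ips_point_t tnth_rshift tnth_lshift.
  by case: (unliftP ord0 k) => [j|] -> //=; rewrite ord1.
- by rewrite ips_point_s !tnth_rshift tnth_mktuple.
Qed.

Lemma mmap_ips_subst (R : comNzRingType) (phi : {rmorphism F -> R})
    (P : 'I_n -> R) C a b (h : 'I_n -> {mpoly F[n]}) :
  mmap phi P (ips_subst C a b h) =
  mmap phi (ips_point P (mmap phi P a) (mmap phi P b) (mmap phi P \o h)) C.
Proof.
rewrite ips_substE (rmorph_mmap (phi' := phi)) => [|c]; last exact: mmapC.
apply: eq_mmap => v; rewrite ips_point_comp /ips_point; case: split => //= i.
by rewrite mmapX mmap1U.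
Qed.

Lemma ips_subst_affine C a b h :
  (forall m, m \in msupp C -> m (t_var n ord_max) <= 1)%N ->
  ips_subst C a b h = (1 - b) * ips_subst C a 0 h + b * ips_subst C a 1 h.
Proof.
move=> deg_t2; rewrite !ips_substE (mmap_affine _ _ deg_t2) ips_point_t /=.
by rewrite !(eq_mmap _ _ (ips_point_with_t2 _ _ _ _ _)).
Qed.

Lemma roABP_refutation_degree_gt0 f g (A : roABP F (n + (2 + n))) :
  roABP_ips_lin'_refutation f g A -> (0 < ro_degree A)%N.
Proof.
case=> C0 C1 _; rewrite lt0n; apply/eqP => deg0.
have := oner_neq0 {mpoly F[n]}; rewrite -C0 -C1 => /eqP; apply.
exact: mmap_ro_degree0.
Qed.

Lemma mmap_bool_axiom (R : comNzRingType) (phi : {rmorphism F -> R})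
    (P : 'I_n -> R) i :
  mmap phi P (bool_axiom F i) = P i ^+ 2 - P i.
Proof. by rewrite rmorphB rmorphXn /= mmapX mmap1U. Qed.

(* A variable x_i is read once as itself and once through s_i = x_i^2 - x_i, so
   both reads have to lie on the side that determines the value of x_i. *)
Lemma rank_ips_subst (R : comNzRingType) (phi : {rmorphism F -> R})
    (A : roABP F (n + (2 + n))) (S T : Type) (P : S -> T -> 'I_n -> R)
    (PS : S -> 'I_n -> R) (PT : T -> 'I_n -> R) (side : pred nat) (B j : nat)
    (t1 t2 : F) :
  (n + (2 + n) <= j * B)%N ->
  (forall s t i,
    P s t i = if side (ro_block A B (x_var i)) then PS s i else PT t i) ->
  (forall s t i,
    P s t i = if side (ro_block A B (s_var i)) then PS s i else PT t i) ->
  rank_at_most (ro_width A ^ j) (fun s t =>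
    mmap phi (P s t) (ips_subst (ro_poly A) t1%:MP t2%:MP (@bool_axiom F n))).
Proof.
move=> le_jB Px Ps.
pose ips_value (Q : 'I_n -> R) :=
  ips_point Q (phi t1) (phi t2) (fun i => Q i ^+ 2 - Q i).
apply: eq_rank_at_most (rank_ro_poly phi A (fun s => ips_value (PS s))
  (fun t => ips_value (PT t)) side le_jB) => s t.
rewrite mmap_ips_subst !mmapC; apply: eq_mmap => v; rewrite /ips_value.
case: (ips_varP v) => [i|k|i].
- by rewrite !ips_point_x Px.
- by rewrite !ips_point_t if_same.
- by rewrite !ips_point_s /= mmap_bool_axiom Ps; case: ifP.
Qed.

End IpsSubst.

Section Defect.
Variables (F : fieldType) (n : nat) (f g : {mpoly F[n]}).
Variable C : {mpoly F[n + (2 + n)]}.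
Hypothesis refC : ips_lin'_refutation f g C.

Definition defect : {mpoly F[n]} := 1 - ips_subst C 0 g (@bool_axiom F n).

Section DefectValue.
Variables (R : comNzRingType) (phi : {rmorphism F -> R}) (P : 'I_n -> R).

Lemma mmap_defect :
  mmap phi P defect =
  1 - ((1 - mmap phi P g) * mmap phi P (ips_subst C 0 0 (@bool_axiom F n))
       + mmap phi P g * mmap phi P (ips_subst C 0 1 (@bool_axiom F n))).
Proof.
case: refC => _ _ degC; rewrite /defect (ips_subst_affine _ _ _ (degC _)).
by rewrite rmorphB rmorphD /= !rmorphM /= rmorphB !rmorph1.
Qed.

Lemma mmap_defect_eq0 :
  mmap phi P f = 0 -> mmap phi P defect = 0.
Proof.
move=> f0; case: refC => _ /(congr1 (mmap phi P)) C1 _.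
by rewrite rmorphB /= -C1 !mmap_ips_subst f0 mmap0 subrr.
Qed.

End DefectValue.

Lemma meval_defect_eq1 (a : 'I_n -> F) :
  (forall i, (bool_axiom F i).@[a] = 0) -> g.@[a] = 0 -> defect.@[a] = 1.
Proof.
move=> bool_a g0; case: refC => /(congr1 (meval a)) C0 _ _.
rewrite mevalB meval1 -[RHS]subr0; congr (1 - _).
rewrite -[RHS](meval0 a) -C0 /meval !mmap_ips_subst; apply: eq_mmap => v.
rewrite /ips_point; case: split => // w; case: split => [k|i] /=.
  by case: ifP => // _; rewrite mmap0; exact: g0.
by rewrite mmap0; exact: bool_a.
Qed.

End Defect.

Section System.
Variables (F : fieldType) (n : nat).

Section SystemValue.
Variables (R : comNzRingType) (phi : {rmorphism F -> R}) (P : 'I_n -> R).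

Lemma mmap_f_poly :
  mmap phi P (f_poly F n) =
  \prod_(i < n) \prod_(j < n | (i < j)%N) (P i + P j + 1).
Proof.
rewrite rmorph_prod; apply: eq_bigr => i _; rewrite rmorph_prod.
apply: eq_bigr => j _ /=.
by rewrite !rmorphD rmorph1 /= !mmapX !mmap1U.
Qed.

Lemma mmap_f_poly_eq0 i j :
  i != j -> P i + P j + 1 = 0 -> mmap phi P (f_poly F n) = 0.
Proof.
wlog lt_ij : i j / (i < j)%N => [IH ne_ij Pij|_ Pij].
  case: (ltngtP i j) => [lt_ij|lt_ji|/val_inj eq_ij].
  - exact: IH lt_ij ne_ij Pij.
  - by apply: IH lt_ji _ _; rewrite 1?eq_sym // (addrC (P j)).
  - by rewrite eq_ij eqxx in ne_ij.
by rewrite mmap_f_poly (bigD1 i) //= (bigD1 j) //= Pij !mul0r.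
Qed.

Lemma mmap_g_poly :
  mmap phi P (g_poly F n) = \prod_(i < n) (1 - P i) - 1.
Proof.
rewrite rmorphB rmorph1 rmorph_prod; congr (_ - _); apply: eq_bigr => i _.
by rewrite rmorphB rmorph1 /= mmapX mmap1U.
Qed.

End SystemValue.

(* On the Boolean cube g vanishes only at the origin, where f = 1. *)
Lemma unsatisfiable_f_g : ~ satisfiable (f_poly F n) (g_poly F n).
Proof.
move=> [a []]; rewrite /meval mmap_f_poly mmap_g_poly => f0 g0 bool_a.
have a0 i : a i = 0.
  have := bool_a i; rewrite mmap_bool_axiom => /eqP.
  rewrite -[X in _ - X]mul1r expr2 -mulrBl mulf_eq0 => /orP[|/eqP //].
  rewrite subr_eq0 => /eqP ai1; move/eqP: g0.
  by rewrite (bigD1 i) //= ai1 subrr mul0r sub0r oppr_eq0 oner_eq0.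
move/eqP: f0; rewrite big1 ?oner_eq0 // => i _.
by rewrite big1 // => j _; rewrite !a0 !add0r.
Qed.

End System.

Section MixedPoint.
Variables (F : fieldType) (n m : nat) (pair_of : 'I_n -> option 'I_m).
Variable in_row : pred 'I_n.
Implicit Types (s t : {ffun 'I_m -> bool}).

(* The literals are chosen so that opposite ones sum to -1, while agreeing ones
   have a common zero. *)
Definition literal (b : bool) (k : 'I_m) : {mpoly F[m]} :=
  if b then -1 - 'X_k else 'X_k.

Definition literal_point s (i : 'I_n) : {mpoly F[m]} :=
  if pair_of i is Some k then literal (s k) k else 0.

Definition mixed_point s t (i : 'I_n) : {mpoly F[m]} :=
  literal_point (if in_row i then s else t) i.

Definition literal_zero s (k : 'I_m) : F := if s k then -1 else 0.

Lemma meval_literal_point s i : (literal_point s i).@[literal_zero s] = 0.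
Proof.
rewrite /literal_point; case: (pair_of i) => [k|]; last exact: meval0.
rewrite /literal; case: ifP => sk; last by rewrite mevalXU /literal_zero sk.
by rewrite mevalB mevalN meval1 mevalXU /literal_zero sk subrr.
Qed.

Lemma f_mixed_point_eq0 s t :
  (forall k, exists2 i, in_row i & pair_of i = Some k) ->
  (forall k, exists2 i, ~~ in_row i & pair_of i = Some k) ->
  s != t -> mmap (@mpolyC m F) (mixed_point s t) (f_poly F n) = 0.
Proof.
move=> row_of col_of ne_st; have [k ne_k] : exists k, s k != t k.
  apply/existsP; apply: contraR ne_st => /existsPn eq_st.
  by apply/eqP/ffunP => k; apply/eqP; rewrite -[_ == _]negbK.
have [[i row_i ik] [j /negPf col_j jk]] := (row_of k, col_of k).
apply: (mmap_f_poly_eq0 _ (i := i) (j := j)).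
  by apply: contraTneq row_i => ->; rewrite col_j.
rewrite /mixed_point row_i col_j /literal_point ik jk.
by case: (s k) (t k) ne_k => [] [] //= _; rewrite /literal; ring.
Qed.

Lemma rank_g_mixed_point :
  rank_at_most 2 (fun s t => mmap (@mpolyC m F) (mixed_point s t) (g_poly F n)).
Proof.
pose row_prod s := \prod_(i | in_row i) (1 - literal_point s i).
pose col_prod t := \prod_(i | ~~ in_row i) (1 - literal_point t i).
apply: eq_rank_at_most (rank_at_mostB (rank_at_most_outer row_prod col_prod)
  (rank_at_most_const _ _ 1)) => s t.
rewrite mmap_g_poly (bigID in_row) /=; congr (_ * _ - 1).
  by apply: eq_bigr => i row_i; rewrite /mixed_point row_i.
by apply: eq_bigr => i /negPf col_i; rewrite /mixed_point col_i.
Qed.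

End MixedPoint.

Section Width.
Variables (F : fieldType) (n m : nat) (pair_of : 'I_n -> option 'I_m).
Variables (A : roABP F (n + (2 + n))) (side : pred nat) (B j : nat).
Hypothesis refA : roABP_ips_lin'_refutation (f_poly F n) (g_poly F n) A.

Let in_row i := side (ro_block A B (x_var i)).

Definition defect_matrix (s t : {ffun 'I_m -> bool}) : {mpoly F[m]} :=
  mmap (@mpolyC m F) (mixed_point F pair_of in_row s t)
    (defect (g_poly F n) (ro_poly A)).

Hypothesis row_of : forall k, exists2 i, in_row i & pair_of i = Some k.
Hypothesis col_of : forall k, exists2 i, ~~ in_row i & pair_of i = Some k.

Lemma defect_matrix_offdiag s t : s != t -> defect_matrix s t = 0.
Proof.
by move=> ne_st; apply: (mmap_defect_eq0 refA); exact: f_mixed_point_eq0.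
Qed.

Lemma defect_matrix_diag s : defect_matrix s s != 0.
Proof.
suff : (defect_matrix s s).@[literal_zero F s] = 1.
  by apply: contra_eq_neq => ->; rewrite meval0 eq_sym oner_eq0.
rewrite /defect_matrix (rmorph_mmap (phi' := idfun)); last exact: mevalC.
have point0 i : (mixed_point F pair_of in_row s s i).@[literal_zero F s] = 0.
  by rewrite /mixed_point if_same meval_literal_point.
apply: (meval_defect_eq1 refA) => [i|].
  by rewrite /meval mmap_bool_axiom /= point0 expr0n subrr.
by rewrite /meval mmap_g_poly big1 ?subrr // => i _; rewrite /= point0 subr0.
Qed.

Hypothesis le_jB : (n + (2 + n) <= j * B)%N.
Hypothesis same_side :
  forall i, pair_of i -> side (ro_block A B (s_var i)) = in_row i.

Lemma rank_defect_matrix : rank_at_most (1 + 5 * ro_width A ^ j) defect_matrix.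
Proof.
have rk_t2 b : rank_at_most (ro_width A ^ j) (fun s t => mmap (@mpolyC m F)
    (mixed_point F pair_of in_row s t)
    (ips_subst (ro_poly A) 0 b%:MP (@bool_axiom F n))).
  rewrite -mpolyC0; pose pt := literal_point F pair_of.
  apply: (@rank_ips_subst F n _ (@mpolyC m F) A _ _ _ pt pt side B j 0 b)
    => // s t i; rewrite /mixed_point.
    by rewrite /in_row; case: ifP.
  rewrite /pt /literal_point; case: (pair_of i) (@same_side i) => [k|_].
    by move=> /(_ isT) ->; case: ifP.
  by rewrite if_same.
pose rk_one := rank_at_most_const {ffun 'I_m -> bool} {ffun 'I_m -> bool}
  (1 : {mpoly F[m]}).
have rk_g := rank_g_mixed_point F pair_of in_row.
rewrite (_ : (5 * _ = 3 * ro_width A ^ j + 2 * ro_width A ^ j)%N); last by lia.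
apply: eq_rank_at_most (rank_at_mostB rk_one (rank_at_mostD
  (rank_at_mostM (rank_at_mostB rk_one rk_g) (rk_t2 0))
  (rank_at_mostM rk_g (rk_t2 1)))) => s t.
by rewrite /defect_matrix (mmap_defect refA) mpolyC0 mpolyC1.
Qed.

Lemma pairing_width_bound : (2 ^ m <= 1 + 5 * ro_width A ^ j)%N.
Proof.
have := rank_at_most_diag defect_matrix_offdiag defect_matrix_diag
  rank_defect_matrix.
by rewrite card_ffun card_bool card_ord.
Qed.

End Width.

Lemma roABP_refutation_width_bound (F : fieldType) (n m : nat)
    (A : roABP F (n + (2 + n))) :
  (6 * m + 9 <= n)%N ->
  roABP_ips_lin'_refutation (f_poly F n) (g_poly F n) A ->
  (2 ^ m <= 1 + 5 * ro_width A ^ 4)%N.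
Proof.
move=> le_m refA; set B := ((n + (2 + n)) %/ 4).+1.
have le_N : (n + (2 + n) <= 4 * B)%N by rewrite /B; lia.
pose block_x i := ro_block A B (x_var i).
pose block_s i := ro_block A B (s_var i).
have block_lt4 v : (ro_block A B v < 4)%N.
  by rewrite ltn_divLR // (leq_trans (ltn_ord _)).
have card_block b :
    (#|[set i | block_x i == b]| + #|[set i | block_s i == b]| <= B)%N.
  apply: leq_trans (card_ro_block A b (ltn0Sn _)).
  apply: leq_card_preim_disjoint => [i j /lshift_inj //||i j].
    by move=> i j /rshift_inj/rshift_inj.
  by rewrite eq_lrshift.
have [||side [pair_of [same_side row_of col_of]]] :=
    exists_balanced_pairing card_block (fun i => block_lt4 (x_var i))
      (fun i => block_lt4 (s_var i)) (d := 3) (m := m).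
- by rewrite card_ord /B; lia.
- by rewrite card_ord.
exact: pairing_width_bound refA row_of col_of le_N same_side.
Qed.

Lemma roABP_refutation_size_bound (F : fieldType) (n : nat)
    (A : roABP F (n + (2 + n))) :
  (224 <= n)%N -> roABP_ips_lin'_refutation (f_poly F n) (g_poly F n) A ->
  (2 ^ n <= ro_size A ^ 28)%N.
Proof.
move=> n_large refA; set m := ((n - 9) %/ 6)%N; set s := ro_size A.
have width_bound : (2 ^ m <= 1 + 5 * ro_width A ^ 4)%N.
  by apply: roABP_refutation_width_bound refA; rewrite /m; lia.
have width_gt0 : (0 < ro_width A)%N.
  rewrite lt0n; apply: contraTneq width_bound => ->.
  by rewrite -ltnNge (@ltn_exp2l 2 0) // /m; lia.
have le_width_s : (ro_width A <= s)%N.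
  have deg_gt0 := roABP_refutation_degree_gt0 refA.
  by rewrite /s /ro_size -mulnA mulnAC leq_pmull // !muln_gt0 deg_gt0; lia.
have le_s4 : (2 ^ (m - 3) <= s ^ 4)%N.
  have m_ge3 : (3 <= m)%N by rewrite /m; lia.
  rewrite -(leq_pmul2l (isT : 0 < 2 ^ 3)%N) -expnD subnKC //.
  have : (1 <= ro_width A ^ 4 <= s ^ 4)%N.
    by rewrite expn_gt0 width_gt0 leq_exp2r.
  by move: width_bound; rewrite (_ : 2 ^ 3 = 8)%N //; lia.
rewrite (expnM s 4 7); apply: (@leq_trans ((2 ^ (m - 3)) ^ 7)).
  by rewrite -expnM leq_exp2l // /m; lia.
by rewrite leq_exp2r.
Qed.

Theorem theorem5p9 (R : realType) (q : nat) (hq : prime q) :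
  (forall (F : finFieldType) (n : nat), q \in [pchar F] ->
     ~ satisfiable (f_poly F n) (g_poly F n)) /\
  (exists (c : R) (n0 : nat), 0 < c /\
     forall (F : finFieldType) (n : nat), q \in [pchar F] -> (n0 <= n)%N ->
     forall A : roABP F (n + (2 + n)),
       roABP_ips_lin'_refutation (f_poly F n) (g_poly F n) A ->
       expR (c * n%:R) <= (ro_size A)%:R).
Proof.
split=> [F n _|]; first exact: unsatisfiable_f_g.
exists (ln 2%:R / 28%:R), 224%N; split=> [|F n _ n_large A refA].
  by rewrite divr_gt0 ?ltr0n // ln_gt0 // ltr1n.
rewrite -(@ler_pXn2r _ 28) ?nnegrE ?expR_ge0 ?ler0n // -expRM_natr.
rewrite mulrAC divfK ?pnatr_eq0 // expRM_natr lnK ?posrE ?ltr0n //.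
by rewrite -!natrX ler_nat roABP_refutation_size_bound.
Qed.
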